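(* Let $D\subset\mathbb R^{n(N+1)}$ be an open convex set. Assume that $G$ is continuously differentiable in $D$ and that its Jacobian is Lipschitz continuous in $D$ with constant $L_2>0$, i.e. $\|G'(\mathbf u)-G'(\mathbf v)\|\le L_2\|\mathbf u-\mathbf v\|$ for all $\mathbf u,\mathbf v\in D$. Let $c>0$ be an upper bound on the norm of the initial error, $\|\mathbf e_0\|\le c$, and let $0<\alpha<1$ be such that for every $\mathbf x\in D$ $$\big\|\big(G'(\mathbf x)^TG'(\mathbf x)+\alpha H^TH\big)^{-1}G'(\mathbf x)^T\big\|\le (L_2c)^{-1},\qquad \|H^T\eta\|\,\big\|\big(G'(\mathbf x)^TG'(\mathbf x)+\alpha H^TH\big)^{-1}\big\|\le \frac c2 .$$ Let the observations be noisy, $\mathbf y=H\mathbf u^\dagger+\eta$. Let $(\mathbf u^{(k)})_{k\ge0}$ be the Gauss-Newton data-assimilation iteration with this $\alpha$, and let $\mathbf e_k=\mathbf u^{(k)}-\mathbf u^\dagger$. Then $$\limsup_{k\to\infty}\|\mathbf e_k\|\le\frac{\alpha c}{1-\alpha},$$ provided the iterate $\mathbf u^{(k)}$ does not leave the convex set $D$ for all $k$.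
   Context: Norms: $\|\cdot\|$ is the Euclidean norm for vectors (in any dimension) and the induced operator norm for matrices. Model: let $n,N\ge1$ and let $F_j:\mathbb R^n\to\mathbb R^n$, $j=0,\dots,N-1$, be twice continuously differentiable. The true solution $\mathbf u^\dagger=(u_0^\dagger,\dots,u_N^\dagger)\in\mathbb R^{n(N+1)}$ satisfies $u^\dagger_{j+1}=F_j(u^\dagger_j)$ for $j=0,\dots,N-1$. For $\mathbf u=(u_0,\dots,u_N)\in\mathbb R^{n(N+1)}$ define $G(\mathbf u)=(G_0(\mathbf u),\dots,G_{N-1}(\mathbf u))^T\in\mathbb R^{nN}$ with $G_j(\mathbf u)=u_{j+1}-F_j(u_j)$. The Jacobian $G'(\mathbf u)$ is the block bidiagonal matrix whose $j$-th block row ($j=0,\dots,N-1$) has $-F_j'(u_j)$ in block column $j$, the identity $I$ in block column $j+1$, and zeros elsewhere. Observations: at time indices $0\le k_0<\dots<k_M\le N$ one has linear observation operators $\mathcal H_{k_i}:\mathbb R^n\to\mathbb R^p$, $p\le n$, and observations $y_{k_i}=\mathcal H_{k_i}u^\dagger_{k_i}+\eta_{k_i}$, where $\eta_{k_i}\in\mathbb R^p$ is a bounded observation noise, either deterministic or stochastic. Put $\mathbf y=(y_{k_0},\dots,y_{k_M})$, $\eta=(\eta_{k_0},\dots,\eta_{k_M})$, and let $H$ be the linear map $H\mathbf u=(\mathcal H_{k_0}u_{k_0},\dots,\mathcal H_{k_M}u_{k_M})$ on $\mathbb R^{n(N+1)}$, so $\mathbf y=H\mathbf u^\dagger+\eta$.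 Gauss-Newton data-assimilation iteration with parameter $\alpha$: the initial guess is $\mathbf u^{(0)}=H^T\mathbf y+(I-H^TH)\mathbf u^b$, where $\mathbf u^b\in\mathbb R^{n(N+1)}$ is a given background solution, and for $k\ge0$ $$\mathbf u^{(k+1)}=\mathbf u^{(k)}-\big(G'(\mathbf u^{(k)})^TG'(\mathbf u^{(k)})+\alpha H^TH\big)^{-1}\big(G'(\mathbf u^{(k)})^TG(\mathbf u^{(k)})+\alpha H^T(H\mathbf u^{(k)}-\mathbf y)\big).$$
   Formalization: The formal theorem additionally assumes that the true solution u† lies in D; without this the claim fails, for instance when D is a small ball around a different zero of G that fits the same observations. *)

(* Defs.v *)
From HB Require Import structures.
From mathcomp Require Import all_boot all_order all_algebra.
From mathcomp Require Import all_classical all_reals all_analysis.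

Set Implicit Arguments.
Unset Strict Implicit.
Unset Printing Implicit Defensive.

Import Order.TTheory GRing.Theory Num.Theory.
Import numFieldNormedType.Exports.

Local Open Scope classical_set_scope.
Local Open Scope ring_scope.

(* 'bV[R]_(q, n) is R^(n q) seen as q stacked blocks of size n: the blocks of
   u are [submxcol u j : 'cV[R]_n], and [\mxcol_j] assembles them. *)
Notation "''bV[' R ]_ ( q , n )" :=
  ('cV[R]_(\sum_(j < q) n))
  (at level 0, format "''bV[' R ]_ ( q ,  n )") : type_scope.

Section Norms.
Context {R : realType}.

(* The library norm of a matrix is the max norm; it induces the same topology
   as the Euclidean one, which is all that [open], [differentiable] and
   [continuous] depend on. *)
Definition enorm m (x : 'cV[R]_m) : R := Num.sqrt (\sum_i x i 0 ^+ 2).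

Definition opnorm m n (A : 'M[R]_(m, n)) : R :=
  sup [set enorm (A *m x) | x in [set x : 'cV[R]_n | enorm x <= 1]].

End Norms.

Section Smoothness.
Context {R : realType}.

(* Meant for open [A], [V] finite-dimensional: then pointwise continuity of
   ['d f] in each direction is its continuity in operator norm. *)
Definition C1_on (V W : normedModType R) (A : set V) (f : V -> W) : Prop :=
  forall x, A x ->
    differentiable f x /\ forall h, {for x, continuous (fun z => 'd f z h)}.

Definition C2 (V W : normedModType R) (f : V -> W) : Prop :=
  C1_on setT f /\ forall h, C1_on setT (fun x => 'd f x h).

(* The column-vector counterpart of [jacobian], which acts on row vectors. *)
Definition cjacobian m n (f : 'cV[R]_n -> 'cV[R]_m) (x : 'cV[R]_n) :
    'M[R]_(m, n) :=
  \matrix_(i, j) 'd f x (delta_mx j 0) i 0.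

Lemma cjacobianE m n (f : 'cV[R]_n -> 'cV[R]_m) (x h : 'cV[R]_n) :
  cjacobian f x *m h = 'd f x h.
Proof.
rewrite [in RHS](matrix_sum_delta h) linear_sum/=.
apply/colP => i; rewrite !mxE summxE; apply: eq_bigr => j _.
by rewrite big_ord1 linearZ !mxE mulrC.
Qed.

End Smoothness.

Section Model.
Context {R : realType} (n N : nat).
Variable F : 'I_N -> 'cV[R]_n -> 'cV[R]_n.

Definition cur (j : 'I_N) : 'I_N.+1 := widen_ord (leqnSn N) j.
Definition next (j : 'I_N) : 'I_N.+1 := lift ord0 j.

Definition is_trajectory (u : 'bV[R]_(N.+1, n)) : Prop :=
  forall j : 'I_N, submxcol u (next j) = F j (submxcol u (cur j)).

Definition model_map (u : 'bV[R]_(N.+1, n)) : 'bV[R]_(N, n) :=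
  \mxcol_(j < N) (submxcol u (next j) - F j (submxcol u (cur j))).

Definition model_jac (u : 'bV[R]_(N.+1, n)) :
    'M[R]_(\sum_(j < N) n, \sum_(l < N.+1) n) :=
  \mxblock_(j < N, l < N.+1)
    (if l == cur j then - cjacobian (F j) (submxcol u (cur j))
     else if l == next j then 1%:M else 0).

End Model.

Section Observation.
Context {R : realType} (n p N M : nat).
Variables (t : 'I_M.+1 -> 'I_N.+1) (Hobs : 'I_M.+1 -> 'M[R]_(p, n)).

(* [t i] is the i-th observation time. *)
Definition obs_mx :
    'M[R]_(\sum_(i < M.+1) p, \sum_(l < N.+1) n) :=
  \mxblock_(i < M.+1, l < N.+1) (if l == t i then Hobs i else 0).

Lemma obs_mxE (u : 'bV[R]_(N.+1, n)) :
  obs_mx *m u = \mxcol_(i < M.+1) (Hobs i *m submxcol u (t i)).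
Proof.
rewrite -[in LHS](submxcolK u) mul_mxblock_mxrow.
apply: eq_mxcol => i; rewrite (bigD1 (t i))//= eqxx big1 ?addr0// => l lti.
by rewrite (negbTE lti) mul0mx.
Qed.

End Observation.

Section GaussNewton.
Context {R : realType} (a b q : nat).
Variables (G : 'cV[R]_a -> 'cV[R]_b) (G' : 'cV[R]_a -> 'M[R]_(b, a)).
Variables (H : 'M[R]_(q, a)) (alpha : R).

Definition normal_mx (x : 'cV[R]_a) : 'M[R]_a :=
  (G' x)^T *m G' x + alpha *: (H^T *m H).

Variables (y : 'cV[R]_q) (ub : 'cV[R]_a).

(* [invmx] is the identity on singular matrices: the recursion has its meaning
   only as long as [normal_mx] is invertible at the iterates. *)
Fixpoint gauss_newton (k : nat) : 'cV[R]_a :=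
  if k is k'.+1 then
    let u := gauss_newton k' in
    u - invmx (normal_mx u) *m
          ((G' u)^T *m G u + alpha *: (H^T *m (H *m u - y)))
  else H^T *m y + (1%:M - H^T *m H) *m ub.

End GaussNewton.

(* Main.v *)
Require Import Defs.
From HB Require Import structures.
From mathcomp Require Import all_boot all_order all_algebra.
From mathcomp Require Import all_classical all_reals all_analysis.
From mathcomp Require Import ring lra.

Import Order.TTheory GRing.Theory Num.Theory.
Import numFieldNormedType.Exports.

Local Open Scope classical_set_scope.
Local Open Scope ring_scope.

(** The error of one Gauss-Newton step is quadratic in the previous error, up to
a contribution of the noise, and the smallness assumptions turn this into a
contraction by [1/2] towards a ball. Write [x] for the true solution, so
that [G x = 0], let [e = u_k - x], and let [A = G'^T G' + alpha H^T H] be the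
matrix of the normal equations at [u_k]. Substituting [y = H x + eta] and
[e = A^-1 A e] in the update makes all the terms in [H e] cancel, and leaves
(see [gauss_newton_error])

  [e_(k+1) = A^-1 G'^T (G' e - (G u_k - G x)) + alpha A^-1 H^T eta].

The bracket is a first-order Taylor remainder along the segment from [x] to
[u_k]; this segment lies in [D] by convexity and the derivative of [G] is
[L2]-Lipschitz there, so the remainder is at most [L2/2 |e|^2]
([linearization_remainder_le]). The two operator norm bounds then give

  [|e_(k+1)| <= |e_k|^2 / (2 c) + alpha c / 2].

From [|e_0| <= c] it follows that [|e_k| <= c] for all [k], hence
[|e_k|^2 / (2 c) <= |e_k| / 2]: the recursion is dominated by the affine one
with slope [1/2] and fixed point [alpha c], so that
[|e_k| <= alpha c + c 2^-k]. The limit superior is thus at most [alpha c],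
which is smaller than [alpha c / (1 - alpha)]. *)

(** * Euclidean norm and operator norm *)

Section EuclideanNorm.
Context {R : realType}.

Definition dot {m} (x y : 'cV[R]_m) : R := \sum_i x i 0 * y i 0.

Lemma dotDr m (x y z : 'cV[R]_m) : dot x (y + z) = dot x y + dot x z.
Proof. by rewrite -big_split; apply: eq_bigr => i _; rewrite mxE mulrDr. Qed.

Lemma dotNr m (x y : 'cV[R]_m) : dot x (- y) = - dot x y.
Proof. by rewrite -sumrN; apply: eq_bigr => i _; rewrite mxE mulrN. Qed.

Lemma dotZr m (k : R) (x y : 'cV[R]_m) : dot x (k *: y) = k * dot x y.
Proof. by rewrite mulr_sumr; apply: eq_bigr => i _; rewrite mxE mulrCA. Qed.

Lemma dotC m (x y : 'cV[R]_m) : dot x y = dot y x.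
Proof. by apply: eq_bigr => i _; rewrite mulrC. Qed.

Lemma dot_ge0 m (x : 'cV[R]_m) : 0 <= dot x x.
Proof. by apply: sumr_ge0 => i _; rewrite -expr2 sqr_ge0. Qed.

Lemma enorm_ge0 m (x : 'cV[R]_m) : 0 <= enorm x.
Proof. exact: sqrtr_ge0. Qed.

Lemma sqr_enorm m (x : 'cV[R]_m) : enorm x ^+ 2 = dot x x.
Proof.
by rewrite sqr_sqrtr; [exact: eq_bigr|apply: sumr_ge0 => i _; exact: sqr_ge0].
Qed.

Lemma enorm_le m (x : 'cV[R]_m) (a : R) :
  0 <= a -> dot x x <= a ^+ 2 -> enorm x <= a.
Proof.
by move=> a0 xa; rewrite -ler_sqr ?nnegrE ?enorm_ge0// sqr_enorm.
Qed.

Lemma enorm0 m : enorm (0 : 'cV[R]_m) = 0.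
Proof.
by rewrite /enorm big1 ?sqrtr0// => i _; rewrite mxE expr0n.
Qed.

Lemma enorm_eq0 m (x : 'cV[R]_m) : enorm x = 0 -> x = 0.
Proof.
move=> x0; have := sqr_enorm _ x; rewrite x0 expr0n/= => /esym/eqP.
rewrite psumr_eq0 => [/allP x00|i _]; last by rewrite -expr2 sqr_ge0.
apply/colP => i; rewrite mxE; apply/eqP.
by have := x00 i (mem_index_enum _); rewrite -expr2 sqrf_eq0.
Qed.

Lemma enormZ m (k : R) (x : 'cV[R]_m) : enorm (k *: x) = `|k| * enorm x.
Proof.
rewrite -sqrtr_sqr -sqrtrM ?sqr_ge0// /enorm mulr_sumr; congr Num.sqrt.
by apply: eq_bigr => i _; rewrite mxE exprMn.
Qed.

(** Cauchy-Schwarz: expand the squared norm of [<x,x> y - <x,y> x]. *)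
Lemma dot_le_enorm m (x y : 'cV[R]_m) : dot x y <= enorm x * enorm y.
Proof.
have [x0|x0] := eqVneq (enorm x) 0.
  rewrite x0 mul0r (enorm_eq0 _ _ x0) /dot big1// => i _.
  by rewrite mxE mul0r.
have : 0 <= dot (dot x x *: y - dot x y *: x) (dot x x *: y - dot x y *: x).
  exact: dot_ge0.
have -> : dot (dot x x *: y - dot x y *: x) (dot x x *: y - dot x y *: x) =
    dot x x * (dot x x * dot y y - dot x y ^+ 2).
  rewrite dotDr dotNr !dotZr ![dot (_ - _) _]dotC !(dotDr, dotNr, dotZr).
  by rewrite [dot y x]dotC; ring.
have a_gt0 : 0 < dot x x.
  by rewrite -sqr_enorm exprn_gt0// lt_neqAle eq_sym x0 enorm_ge0.
rewrite pmulr_rge0// subr_ge0 -!sqr_enorm -exprMn => le2.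
apply: (le_trans (ler_norm _)).
by rewrite -ler_sqr ?nnegrE ?mulr_ge0 ?enorm_ge0// real_normK// num_real.
Qed.

Lemma ler_enormD m (x y : 'cV[R]_m) : enorm (x + y) <= enorm x + enorm y.
Proof.
apply: enorm_le; first by rewrite addr_ge0 ?enorm_ge0.
rewrite dotDr dotC dotDr [dot (x + y) y]dotC dotDr -!sqr_enorm [dot y x]dotC.
by have := dot_le_enorm _ x y; nra.
Qed.

(** [opnorm] is a supremum of reals, hence a junk value on unbounded sets; this
is what gives it its meaning. The bound used is the Frobenius norm. *)
Lemma opnorm_has_ubound m n (A : 'M[R]_(m, n)) :
  has_ubound [set enorm (A *m x) | x in [set x : 'cV[R]_n | enorm x <= 1]].
Proof.
exists (Num.sqrt (\sum_i enorm (row i A)^T ^+ 2)) => _ [x /= x1 <-].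
have S0 : 0 <= \sum_i enorm (row i A)^T ^+ 2.
  by apply: sumr_ge0 => i _; exact: sqr_ge0.
apply: enorm_le; first exact: sqrtr_ge0.
rewrite sqr_sqrtr//; apply: ler_sum => i _; rewrite -expr2.
have -> : (A *m x) i 0 = dot (row i A)^T x.
  by rewrite mxE; apply: eq_bigr => j _; rewrite !mxE.
(* Applied to x and to - x, this bounds the modulus of the dot product. *)
have le1 y : dot (row i A)^T y <= enorm (row i A)^T * enorm y.
  exact: dot_le_enorm.
have r0 := enorm_ge0 _ (row i A)^T.
have := le1 x; have := le1 (- x); rewrite dotNr.
rewrite -[- x]scaleN1r enormZ normrN1 mul1r.
by move=> ? ?; have : enorm (row i A)^T * enorm x <= enorm (row i A)^T; nra.
Qed.

Lemma enorm_mulmx_le m n (A : 'M[R]_(m, n)) (x : 'cV[R]_n) :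
  enorm (A *m x) <= opnorm A * enorm x.
Proof.
have [x0|x0] := eqVneq (enorm x) 0.
  by rewrite x0 (enorm_eq0 _ _ x0) mulmx0 enorm0 mulr0.
have x_gt0 : 0 < enorm x by rewrite lt_neqAle eq_sym x0 enorm_ge0.
rewrite -ler_pdivrMr// mulrC.
have xV0 : 0 <= (enorm x)^-1 by rewrite invr_ge0 enorm_ge0.
rewrite -[X in X * _](ger0_norm xV0) -enormZ scalemxAr.
apply: ub_le_sup; first exact: opnorm_has_ubound.
by exists ((enorm x)^-1 *: x) => //=; rewrite enormZ ger0_norm// mulVf.
Qed.

End EuclideanNorm.

(** * Directional derivatives *)

Section DirectionalDerivatives.
Context {R : realType}.

(** A chain rule which asks nothing of [g] beyond being affine along the line
through [x] in the direction [h]: the two difference quotients are then equal.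
It serves for the segments (affine maps from [R]) as well as for the extraction
of a block (a linear map). *)
Lemma is_derive_comp_affine (U V W : normedModType R) (f : V -> W) (g : U -> V)
    (x h : U) (h' : V) (df : W) :
  (forall k : R, g (k *: h + x) = k *: h' + g x) ->
  is_derive (g x) h' f df -> is_derive x h (f \o g) df.
Proof.
move=> gE [f_derivable fE].
have quotE :
    (fun k : R => k^-1 *: (((f \o g) \o shift x) (k *: h) - (f \o g) x))
    = (fun k : R => k^-1 *: ((f \o shift (g x)) (k *: h') - f (g x))).
  by apply/funext => k /=; rewrite gE.
by split; rewrite /derivable /derive quotE.
Qed.

Lemma is_derive_mxP (V : normedModType R) m n (f : V -> 'M[R]_(m, n)) (x h : V)
    (df : 'M[R]_(m, n)) :
  is_derive x h f df <->
  forall i j, is_derive x h (fun z => f z i j) (df i j).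
Proof.
split=> [[f_derivable <-] i j|fij].
  by split; [move/derivable_mxP: f_derivable; exact|rewrite derive_mx// mxE].
have f_derivable : derivable f x h.
  by apply/derivable_mxP => i j; case: (fij i j).
split=> //; rewrite derive_mx//; apply/matrixP => i j; rewrite mxE.
by case: (fij i j).
Qed.

Lemma is_derive_dot (V : normedModType R) m (r : 'cV[R]_m) (f : V -> 'cV[R]_m)
    (x h : V) (df : 'cV[R]_m) :
  is_derive x h f df -> is_derive x h (fun z => dot r (f z)) (dot r df).
Proof.
move=> /is_derive_mxP fij.
have -> : (fun z => dot r (f z)) = \sum_i (r i 0 \*: (fun z => f z i 0)).
  by apply/funext => z; rewrite fct_sumE.
by apply: is_derive_sum => i; apply: is_deriveZ.
Qed.

Lemma convex_segment (V : lmodType R) (D : set V) (x z : V) (s : R) :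
  convex_set D -> D x -> D z -> 0 <= s <= 1 -> D (x + s *: (z - x)).
Proof.
move=> Dc Dx Dz /andP[s0 s1].
have i01s : Itv.spec (@Itv.num_sem R) (Itv.Real `[0%Z, 1%Z]) s.
  by rewrite /= /Itv.num_sem/= num_real/= in_itv/= s0 s1.
have := Dc z x (Itv.mk i01s); rewrite !inE => /(_ Dz Dx); congr D.
by rewrite /conv/= scalerBr scalerBl scale1r addrCA.
Qed.

End DirectionalDerivatives.

(** * First-order remainder of a map with Lipschitz derivative *)

Section Remainder.
Context {R : realType} (a b : nat).
Variables (G : 'cV[R]_a -> 'cV[R]_b) (J : 'cV[R]_a -> 'M[R]_(b, a)).
Variables (D : set 'cV[R]_a) (L : R).
Hypothesis L_ge0 : 0 <= L.
Hypothesis D_convex : convex_set D.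
Hypothesis G_J : forall v h, D v -> is_derive v h G (J v *m h).
Hypothesis J_lip :
  forall v w, D v -> D w -> opnorm (J v - J w) <= L * enorm (v - w).

(** No mean value equality holds for a vector-valued [G], so the remainder [r]
is tested against itself. On the segment [seg s = x + s e] the function [psi]
is chosen so that [psi 0 >= psi 1] is exactly [|r|^2 <= B]. Its derivative is
[<r, (J z - J (seg s)) e> - 2 B (1 - s)], where the dot product is at most
[|r| L (1 - s) |e|^2 = 2 B (1 - s)] because [z - seg s = (1 - s) e]. *)
Lemma linearization_remainder_le (x z : 'cV[R]_a) : D x -> D z ->
  enorm (J z *m (z - x) - (G z - G x)) <= L / 2 * enorm (z - x) ^+ 2.
Proof.
move=> Dx Dz; set e := z - x; set r := J z *m e - (G z - G x).
pose B := L / 2 * enorm e ^+ 2 * enorm r.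
pose seg (s : R) := x + s *: e.
pose psi (s : R) := s * dot r (J z *m e) - dot r (G (seg s)) + B * (1 - s) ^+ 2.
pose dpsi (s : R) :=
  dot r (J z *m e) - dot r (J (seg s) *m e) - 2 * B * (1 - s).
have Dseg (s : R) : 0 <= s <= 1 -> D (seg s).
  by move=> s01; exact: convex_segment.
have psi_derive (s : R) : 0 <= s <= 1 -> is_derive s 1 psi (dpsi s).
  move=> s01.
  have dG : is_derive s 1 (fun t => dot r (G (seg t))) (dot r (J (seg s) *m e)).
    apply: is_derive_dot; apply: (is_derive_comp_affine _ _ _ G seg _ _ e).
      by move=> k; rewrite /seg [_%:A]mulr1 scalerDl addrCA.
    exact: G_J (Dseg _ s01).
  have -> : psi = dot r (J z *m e) \*: id - (fun t => dot r (G (seg t)))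
                + B \*: (cst 1 - id) ^+ 2.
    by apply/funext => t; rewrite /psi/= !fctE mulrC.
  apply: is_derive_eq; rewrite [_%:A]mulr1 /dpsi /GRing.scale/= expr1 !fctE.
  by ring.
have dpsi_le0 (s : R) : 0 <= s <= 1 -> dpsi s <= 0.
  move=> s01; have /andP[s0 s1] := s01; rewrite /dpsi -dotNr -dotDr -mulmxBl.
  rewrite subr_le0; apply: (le_trans (dot_le_enorm _ _ _)).
  have zseg : z - seg s = (1 - s) *: e.
    by rewrite /seg opprD addrA scalerBl scale1r.
  have := J_lip _ _ Dz (Dseg _ s01).
  rewrite zseg enormZ ger0_norm ?subr_ge0// => lip.
  have := enorm_mulmx_le _ _ (J z - J (seg s)) e.
  have := enorm_ge0 _ e; have := enorm_ge0 _ r; rewrite /B => r0 e0 le1.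
  have le2 : enorm ((J z - J (seg s)) *m e) <= L * ((1 - s) * enorm e) * enorm e.
    by apply: (le_trans le1); rewrite ler_wpM2r.
  have := ler_wpM2l r0 le2; move/le_trans; apply.
  by rewrite le_eqVlt; apply/orP; left; apply/eqP; field.
have psi_le : psi 1 <= psi 0.
  have in01 (s : R) : s \in `]0, 1[ -> 0 <= s <= 1.
    by rewrite in_itv/= => /andP[/ltW-> /ltW->].
  apply: (ler0_derive1_le_cc (a := 0) (b := 1)); rewrite ?in_itv/= ?lexx ?ler01//.
  - by move=> s /in01 /psi_derive [].
  - by move=> s /in01 s01; rewrite derive1E; have [_ ->] := psi_derive s s01;
      exact: dpsi_le0.
  - apply: derivable_within_continuous => s; rewrite in_itv/=.
    by move=> /psi_derive[].
move: psi_le; rewrite /psi /seg scale0r addr0 scale1r mul0r mul1r sub0r.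
rewrite addrC [x + _]addrC subrK subrr expr0n/= mulr0 add0r.
rewrite subr0 expr1n mulr1 => psi_le.
have : enorm r ^+ 2 <= B.
  rewrite sqr_enorm {2}/r dotDr opprB dotDr dotNr; lra.
rewrite /B expr2; have [r0 _|r0] := eqVneq (enorm r) 0; last first.
  by rewrite ler_pM2r// lt_neqAle eq_sym r0 enorm_ge0.
by rewrite r0 mulr_ge0 ?sqr_ge0 ?divr_ge0.
Qed.

End Remainder.

(** * Derivative of the model map *)

Section ModelDerivative.
Context {R : realType} (n N : nat) (F : 'I_N -> 'cV[R]_n -> 'cV[R]_n).

Lemma cur_neq_next (j : 'I_N) : cur j != Defs.next j.
Proof. by rewrite -val_eqE/= /bump leq0n add1n neq_ltn ltnSn. Qed.

Lemma model_jacE (u h : 'bV[R]_(N.+1, n)) :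
  model_jac F u *m h = \mxcol_(j < N) (submxcol h (Defs.next j) -
    cjacobian (F j) (submxcol u (cur j)) *m submxcol h (cur j)).
Proof.
rewrite -[in LHS](submxcolK h) mul_mxblock_mxrow; apply: eq_mxcol => j.
rewrite (bigD1 (cur j))//= (bigD1 (Defs.next j))/=; last first.
  by rewrite eq_sym cur_neq_next.
rewrite !eqxx [Defs.next j == _]eq_sym (negbTE (cur_neq_next j)) mul1mx mulNmx.
by rewrite big1 ?addr0 1?addrC// => l /andP[/negbTE-> /negbTE->]; rewrite mul0mx.
Qed.

Lemma is_derive_model_map (u h : 'bV[R]_(N.+1, n)) :
  (forall j, differentiable (F j) (submxcol u (cur j))) ->
  is_derive u h (model_map F) (model_jac F u *m h).
Proof.
move=> F_diff; rewrite model_jacE; apply/is_derive_mxP => i k.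
have blk (j : 'I_N) : is_derive u h
    (fun z : 'bV[R]_(N.+1, n) =>
       submxcol z (Defs.next j) - F j (submxcol z (cur j)))
    (submxcol h (Defs.next j) -
      cjacobian (F j) (submxcol u (cur j)) *m submxcol h (cur j)).
  apply: is_deriveB.
    apply: (is_derive_comp_affine _ _ _ id (fun z => submxcol z (Defs.next j))).
    by move=> c; apply/matrixP => ? ?; rewrite !mxE.
  apply: (is_derive_comp_affine _ _ _ (F j) (fun z => submxcol z (cur j)));
    last by rewrite cjacobianE -deriveE//; apply/derivableP/diff_derivable.
  by move=> c; apply/matrixP => ? ?; rewrite !mxE.
have -> : (fun z => model_map F z i k) = (fun z : 'bV[R]_(N.+1, n) =>
    (submxcol z (Defs.next (tagnat.sig1 i)) -
     F (tagnat.sig1 i) (submxcol z (cur (tagnat.sig1 i)))) (tagnat.sig2 i) k).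
  by apply/funext => z; rewrite mxE.
by rewrite mxE; move: (blk (tagnat.sig1 i)) => /is_derive_mxP; apply.
Qed.

End ModelDerivative.

Lemma model_map_trajectory (R : realType) (n N : nat)
    (F : 'I_N -> 'cV[R]_n -> 'cV[R]_n) (u : 'bV[R]_(N.+1, n)) :
  is_trajectory F u -> model_map F u = 0.
Proof.
move=> Fu; apply/matrixP => i j; rewrite !mxE.
have /matrixP/(_ (tagnat.sig2 i) j) := Fu (tagnat.sig1 i).
by rewrite !mxE => ->; rewrite subrr.
Qed.

(** * Propagation of the error *)

Section ErrorRecursion.
Context {R : realType} (a b q : nat).
Variables (G : 'cV[R]_a -> 'cV[R]_b) (G' : 'cV[R]_a -> 'M[R]_(b, a)).
Variables (H : 'M[R]_(q, a)) (alpha : R).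
Variables (x ub : 'cV[R]_a) (eta : 'cV[R]_q).
Let u := gauss_newton G G' H alpha (H *m x + eta) ub.
Let A := normal_mx G' H alpha.

Lemma gauss_newton_error k : G x = 0 -> A (u k) \in unitmx ->
  u k.+1 - x =
  invmx (A (u k)) *m (G' (u k))^T *m
    (G' (u k) *m (u k - x) - (G (u k) - G x)) +
  alpha *: (invmx (A (u k)) *m (H^T *m eta)).
Proof.
move=> Gx0 A_unit; rewrite {1}/u/= -/u -/(A (u k)) Gx0 subr0.
move: (u k) A_unit => v A_unit; set e := v - x.
have -> : H *m v - (H *m x + eta) = H *m e - eta.
  by rewrite /e mulmxBr opprD addrA.
rewrite addrAC -/e; clearbody e.
rewrite -{1}(mulKmx A_unit e) -mulmxBr -(mulmxA (invmx (A v))).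
rewrite (scalemxAr alpha (invmx (A v))) -mulmxDr; congr (_ *m _).
rewrite /A /normal_mx mulmxDl -scalemxAl -!mulmxA !mulmxBr scalerBr.
by rewrite opprD opprB addrACA [X in _ + X]addrCA subrr addr0.
Qed.

End ErrorRecursion.

(** * Asymptotic bound *)

Lemma limn_esup_le_geometric (R : realType) (w : nat -> R) (l c z : R) :
  `|z| < 1 -> (forall k, w k <= l + c * z ^+ k) ->
  (limn_esup (fun k => (w k)%:E) <= l%:E)%E.
Proof.
move=> z1 wle.
have bound_cvg : (fun k => (l + c * z ^+ k)%:E) @ \oo --> l%:E.
  apply: cvg_EFin; first exact: nearW.
  rewrite -[X in _ --> X]addr0; apply: cvgD; first exact: cvg_cst.
  exact: cvg_geometric.
rewrite -(cvg_lim _ (cvg_esups bound_cvg))// limn_esup_lim.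
apply: lee_lim; [exact: is_cvg_esups|exact: is_cvg_esups|].
apply: nearW => m; apply: ge_ereal_sup => _ [k mk <-].
apply: (@le_trans _ _ (l + c * z ^+ k)%:E); first by rewrite lee_fin.
by apply: ereal_sup_ubound; exists k.
Qed.

Theorem theorem2 (R : realType) (n N p M : nat)
  (n_ge1 : (1 <= n)%N) (N_ge1 : (1 <= N)%N) (p_le_n : (p <= n)%N)
  (F : 'I_N -> 'cV[R]_n -> 'cV[R]_n)
  (F_C2 : forall j, C2 (F j))
  (udag : 'bV[R]_(N.+1, n))
  (udag_traj : is_trajectory F udag)
  (t : 'I_M.+1 -> 'I_N.+1)
  (t_incr : forall i j : 'I_M.+1, (i < j)%N -> (t i < t j)%N)
  (Hobs : 'I_M.+1 -> 'M[R]_(p, n))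
  (eta y : 'bV[R]_(M.+1, p))
  (ub : 'bV[R]_(N.+1, n))
  (D : set ('bV[R]_(N.+1, n)))
  (L2 c alpha : R) :
  let G := model_map F in
  let G' := model_jac F in
  let H := obs_mx t Hobs in
  let A := normal_mx G' H alpha in
  let u := gauss_newton G G' H alpha y ub in
  let e := fun k => u k - udag in
  y = H *m udag + eta ->
  open D -> convex_set D ->
  D udag ->
  C1_on D G ->
  0 < L2 ->
  (forall v w, D v -> D w -> opnorm (G' v - G' w) <= L2 * enorm (v - w)) ->
  0 < c -> enorm (e 0%N) <= c ->
  0 < alpha -> alpha < 1 ->
  (forall x, D x ->
     [/\ A x \in unitmx,
         opnorm (invmx (A x) *m (G' x)^T) <= (L2 * c)^-1
       & enorm (H^T *m eta) * opnorm (invmx (A x)) <= c / 2]) ->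
  (forall k, D (u k)) ->
  (limn_esup (fun k => (enorm (e k))%:E) <= (alpha * c / (1 - alpha))%:E)%E.
Proof.
move=> G G' H A u e yE D_open D_convex Ddag _ L2_gt0 lip c_gt0 e0c a_gt0 a_lt1
  bounds Du.
have G_udag : G udag = 0 by exact: model_map_trajectory.
have G_derive v h : D v -> is_derive v h G (G' v *m h).
  move=> _; apply: is_derive_model_map => j.
  by have [F_C1 _] := F_C2 j; have [] := F_C1 (submxcol v (cur j)) I.
have step k : enorm (e k.+1) <= enorm (e k) ^+ 2 / (2 * c) + alpha * c / 2.
  have [A_unit le1 le2] := bounds _ (Du k).
  have rem := linearization_remainder_le _ _ _ _ _ _ (ltW L2_gt0) D_convex
    G_derive lip _ _ Ddag (Du k).
  rewrite /e /u yE gauss_newton_error -?yE -/u//.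
  apply: (le_trans (ler_enormD _ _ _)); apply: lerD.
    apply: (le_trans (enorm_mulmx_le _ _ _ _)).
    have LcV : 0 <= (L2 * c)^-1 by rewrite invr_ge0 mulr_ge0// ltW.
    apply: (le_trans (ler_wpM2r (enorm_ge0 _ _) le1)).
    apply: (le_trans (ler_wpM2l LcV rem)).
    rewrite le_eqVlt; apply/orP; left; apply/eqP; field.
    by rewrite !gt_eqF.
  rewrite enormZ gtr0_norm// -mulrA ler_pM2l//.
  by apply: (le_trans (enorm_mulmx_le _ _ _ _)); rewrite mulrC.
(* The first bound makes the quadratic term of the recursion at most half the
   error, which is what propagates the second one. *)
have bound k : enorm (e k) <= c /\ enorm (e k) <= alpha * c + c * 2^-1 ^+ k.
  elim: k => [|k [IH1 IH2]].
    by split=> //; rewrite expr0 mulr1 (le_trans e0c)// lerDr mulr_ge0// ltW.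
  have sq_le : enorm (e k) ^+ 2 / (2 * c) <= enorm (e k) / 2.
    rewrite ler_pdivrMr ?mulr_gt0// mulrA divfK ?pnatr_eq0// expr2.
    by rewrite ler_wpM2l ?enorm_ge0.
  have := step k => ?; split; [nra|rewrite exprS].
  lra.
apply: (@le_trans _ _ (alpha * c)%:E).
  apply: (limn_esup_le_geometric _ _ _ c 2^-1) => [|k]; last exact: (bound k).2.
  by rewrite ger0_norm; lra.
rewrite lee_fin ler_pdivlMr ?subr_gt0//; nra.
Qed.
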